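(* Let $l,r,b,a$ be positive integers with $r<l$ and $b<a$, and consider the recovery set $R=([-l,r]\times[-b,a])\setminus\{(0,0)\}\subset\mathbb Z^2$ (integer intervals). Then $$\mathsf{cap}(\mathbb Z^2_R)=1-\frac1{(r+1)(b+1)}.$$
   Context: Fix a finite alphabet $Q$ of size $q\ge 2$. For a finite $R\subset\mathbb Z^2\setminus\{0\}$, an $R$-recoverable system on $\mathbb Z^2$ is a nonempty set $X\subseteq Q^{\mathbb Z^2}$ such that for every $v\in\mathbb Z^2$ there is a function $f_v:Q^{|R|}\to Q$ (which may depend on $v$) with $x_v=f_v(x_{v+R})$ for all $x\in X$, where $x_{v+R}$ is the restriction of $x$ to $v+R=\{v+z:z\in R\}$. Its rate is $\limsup_{n\to\infty}\frac1{n^2}\log_q|\mathcal B_{[n]^2}(X)|$, where $\mathcal B_{[n]^2}(X)$ is the set of restrictions of the words of $X$ to $[n]^2=\{0,\dots,n-1\}^2$. The capacity $\mathsf{cap}(\mathbb Z^2_R)$ is the supremum of the rates over all $R$-recoverable systems $X\subseteq Q^{\mathbb Z^2}$. *)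

(* Defs.v *)
From HB Require Import structures.
From mathcomp Require Import all_boot all_order all_algebra finmap.
From mathcomp Require Import all_classical all_reals all_analysis.
From mathcomp Require Import zify.

Set Implicit Arguments.
Unset Strict Implicit.
Unset Printing Implicit Defensive.

Import Order.TTheory GRing.Theory Num.Theory.

Local Open Scope classical_set_scope.
Local Open Scope ring_scope.

Notation Z2 := (int * int)%type.

Section RecoverableSystems.
Variables (Q : finType) (S : {fset Z2}).

(* The restriction of x to v + S, indexed by S itself. *)
Definition neighborhood (x : Z2 -> Q) (v : Z2) : {ffun S -> Q} :=
  [ffun z : S => x (v + fsval z)].

Definition recoverable (X : set (Z2 -> Q)) : Prop :=
  X !=set0 /\
  forall v : Z2, exists f : {ffun S -> Q} -> Q,
    forall x, X x -> x v = f (neighborhood x v).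

End RecoverableSystems.

Section Capacity.
Variables (K : realType) (Q : finType).

Definition box_restriction (n : nat) (x : Z2 -> Q) :
    {ffun 'I_n * 'I_n -> Q} :=
  [ffun p : 'I_n * 'I_n => x (Posz p.1, Posz p.2)].

Definition box_words (n : nat) (X : set (Z2 -> Q)) :
    {set {ffun 'I_n * 'I_n -> Q}} :=
  finset (fun w => `[< (box_restriction n @` X) w >]).

(* The value of the sequence at n = 0 is irrelevant to the limsup. *)
Definition rate (X : set (Z2 -> Q)) : \bar K :=
  limn_esup (fun n : nat =>
    ((ln (#|box_words n X|%:R : K) / ln (#|Q|%:R : K)) / n%:R ^+ 2)%:E).

Definition capacity (S : {fset Z2}) : \bar K :=
  ereal_sup [set rate X | X in [set X | recoverable S X]].

End Capacity.

Definition int_interval (m n : nat) : seq int :=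
  [seq Posz k - Posz m | k <- iota 0 (m + n).+1].

Definition recovery_box (l r b a : nat) : {fset Z2} :=
  [fset z in [seq (i, j) | i <- int_interval l r, j <- int_interval b a]
    | z != (0, 0)]%fset.

Lemma mem_int_interval (m n : nat) (i : int) :
  (i \in int_interval m n) = (- Posz m <= i <= Posz n).
Proof.
apply/mapP/andP => [[k]|[h1 h2]].
  by rewrite mem_iota => hk ->; split; lia.
exists (absz (i + Posz m)%R); last by lia.
by rewrite mem_iota; lia.
Qed.

Lemma mem_recovery_box (l r b a : nat) (z : Z2) :
  (z \in recovery_box l r b a) =
  [&& - Posz l <= z.1 <= Posz r, - Posz b <= z.2 <= Posz a & z != (0, 0)].
Proof.
case: z => i j; rewrite -!mem_int_interval andbA in_fset; congr (_ && _).
apply/allpairsP/andP => [[[i' j'] /= [hi hj [-> ->]]] //|[hi hj]].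
by exists (i, j).
Qed.

(* Main.v *)
(* Upper bound: two points of a translate of the sublattice (r+1)Z x (b+1)Z
   that differ by an element of R differ by (-(r+1)i, (b+1)j) with i, j >= 0, so
   within a box the symbols on such a translate are recovered one after the
   other from all the remaining symbols.
   Lower bound: differences of points of an (r+1) x (b+1) rectangle are in
   R U {0}, because r <= l and b <= a; tile the plane by such rectangles and
   ask the symbols of each tile to sum to 0 modulo q. *)
Require Import Defs.
From mathcomp Require Import all_boot all_order all_algebra finmap.
From mathcomp Require Import all_classical all_reals all_analysis.
From mathcomp Require Import zify ring lra.
Import Order.TTheory GRing.Theory Num.Theory.
Import numFieldNormedType.Exports.
Local Open Scope ring_scope.

(** * Density of a residue class in an interval *)

(** The margins keep [[s - lo, s + hi]] inside [[0, n)], so that the recovery set placed at such a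
    point does not leave the box. *)
Definition lattice_points (n lo hi d : nat) : {set 'I_n} :=
  [set s : 'I_n | [&& (lo <= s)%N, (d %| s - lo)%N & (s + hi < n)%N]]%SET.

(** The points [lo + d * i] with [i < (n - (lo + hi)) %/ d] all qualify. *)
Lemma lattice_points_ge (n lo hi d : nat) : (0 < d)%N ->
  (n <= d * #|lattice_points n lo hi d| + (lo + hi + d))%N.
Proof.
move=> d0; pose m := ((n - (lo + hi)) %/ d)%N.
suff hm : (m <= #|lattice_points n lo hi d|)%N.
  apply: (@leq_trans (d * m + (lo + hi + d))); last by rewrite leq_add2r leq_mul2l hm orbT.
  have := divn_eq (n - (lo + hi)) d; have := ltn_pmod (n - (lo + hi)) d0.
  by rewrite -/m mulnC; lia.
have hlt (i : 'I_m) : (lo + d * i + hi < n)%N.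
  have : (d * i.+1 <= n - (lo + hi))%N.
    apply: leq_trans (leq_divM (n - (lo + hi)) d).
    by rewrite mulnC leq_mul2r -/m ltn_ord orbT.
  by rewrite mulnS; lia.
have hlt' (i : 'I_m) : (lo + d * i < n)%N by have := hlt i; lia.
pose f i := Ordinal (hlt' i).
have injf : injective f.
  move=> i j /(congr1 val) /= /addnI /eqP.
  by rewrite eqn_pmul2l // => /eqP /val_inj.
rewrite -[X in (X <= _)%N]card_ord -(card_imset _ injf); apply: subset_leq_card.
apply/fintype.subsetP => _ /imsetP[i _ ->]; rewrite inE /= leq_addr /= addKn dvdn_mulr //=.
Qed.

(** The quotient [(s - lo) %/ d] separates these points and takes at most [n %/ d + 1] values. *)
Lemma lattice_points_le (n lo hi d : nat) : (0 < d)%N ->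
  (d * #|lattice_points n lo hi d| <= n + d)%N.
Proof.
move=> d0; pose f (s : 'I_n) : 'I_(n %/ d).+1 := inord ((s - lo) %/ d).
have : (#|lattice_points n lo hi d| <= #|'I_(n %/ d).+1|)%N.
  apply: (@leq_card_in _ _ f) => s t; rewrite !inE => /and3P[ls ds _] /and3P[lt dt _].
  move=> /(congr1 val); rewrite /= !inordK ?ltnS ?leq_div2r //; [|by have := ltn_ord t; lia|by have := ltn_ord s; lia].
  move=> /(congr1 (muln^~ d)); rewrite !divnK // => h.
  by apply/val_inj => /=; lia.
rewrite card_ord -(leq_pmul2l d0) => /leq_trans; apply.
by rewrite mulnS addnC leq_add2r mulnC leq_divM.
Qed.

(** The two bounds put [u n / n] within [C / (d * n)] of [1 / d]. Shifting to [n.+1] avoids division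
    by 0 and makes the error a multiple of [harmonic]. *)
Lemma cvg_density (K : realType) (u : nat -> nat) (d C : nat) : (0 < d)%N ->
  (forall n, (n <= d * u n + C)%N) -> (forall n, (d * u n <= n + C)%N) ->
  ((fun n => (u n)%:R / n%:R : K) @ \oo --> (d%:R^-1 : K))%classic.
Proof.
move=> d0 lo up; rewrite -cvg_shiftS.
have hc (e : K) : ((fun n => d%:R^-1 + e * harmonic n : K) @ \oo --> (d%:R^-1 : K))%classic.
  rewrite -[X in (_ --> X)%classic]addr0 -[X in _ + X](mulr0 e).
  by apply: cvgD; [exact: cvg_cst|apply: cvgMr; exact: cvg_harmonic].
apply: (squeeze_cvgr _ (hc (- (C%:R / d%:R))) (hc (C%:R / d%:R))).
near=> n; rewrite /harmonic /=.
have dK : 0 < d%:R :> K by rewrite ltr0n.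
have nK : 0 < n.+1%:R :> K by rewrite ltr0n.
have := lo n.+1; have := up n.+1.
rewrite -!(ler_nat K) !natrD !natrM.
move: (n.+1%:R) (d%:R) (C%:R) ((u n.+1)%:R) nK dK => N D c U N0 D0 h1 h2.
have -> : D^-1 + - (c / D) / N = (N - c) / D / N.
  by field; rewrite (gt_eqF N0) (gt_eqF D0).
have -> : D^-1 + c / D / N = (N + c) / D / N.
  by field; rewrite (gt_eqF N0) (gt_eqF D0).
rewrite !ler_pM2r ?invr_gt0 // ler_pdivrMr // ler_pdivlMr //.
by apply/andP; split; lra.
Unshelve. all: by end_near.
Qed.

(** * Counting words by their free positions *)

Section InformationSet.
Variables (T Q : finType) (q0 : Q) (F : {set T}) (B : {set {ffun T -> Q}}).

Let erase (w : {ffun T -> Q}) : {ffun T -> Q} :=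
  [ffun t => if t \in F then q0 else w t].

Let card_erased : #|pffun_on q0 (~: F)%SET (mem Q)| = (#|Q| ^ (#|T| - #|F|))%N.
Proof. by rewrite card_pffun_on cardsCs finset.setCK. Qed.

(** Overwriting [F] by [q0] loses nothing on [B], so [B] injects into the words that are [q0] on
    [F]. *)
Lemma card_determined_le :
  {in B &, forall v w : {ffun T -> Q},
    (forall t, t \notin F -> v t = w t) -> v = w} ->
  (#|B| <= #|Q| ^ (#|T| - #|F|))%N.
Proof.
move=> det; rewrite -card_erased.
have inj : {in B &, injective erase}.
  move=> v w Bv Bw /ffunP e; apply: det => // t /negbTE tF.
  by have := e t; rewrite !ffunE tF.
rewrite -(card_in_imset inj); apply: subset_leq_card.
apply/fintype.subsetP => _ /imsetP[w _ ->]; apply/pffun_onP; split => //.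
apply/fintype.subsetP => t; rewrite !inE ffunE.
by case: ifP => // _; rewrite eqxx.
Qed.

(** Every word that is [q0] on [F] is the erasure of some word of [B]. *)
Lemma card_extendable_ge :
  (forall w, exists2 v, v \in B & forall t, t \notin F -> v t = w t) ->
  (#|Q| ^ (#|T| - #|F|) <= #|B|)%N.
Proof.
move=> ext; rewrite -card_erased; apply: (leq_trans _ (leq_imset_card erase B)).
apply: subset_leq_card; apply/fintype.subsetP => w /pffun_onP[/fintype.subsetP supp _].
have [v Bv vw] := ext w; apply/imsetP; exists v => //.
apply/ffunP => t; rewrite ffunE; case: ifPn => tF; last by rewrite vw.
by apply/eqP; apply: contraLR tF => wt; have := supp t wt; rewrite inE.
Qed.

End InformationSet.

(** * Upper bound on the number of box words *)

(** The integer [t - s] is a multiple of [d] and less than [d], hence not positive. *)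
Lemma congruent_le (d lo s t : nat) :
  (lo <= s)%N -> (d %| s - lo)%N -> (lo <= t)%N -> (d %| t - lo)%N ->
  (t < s + d)%N -> (t <= s)%N.
Proof.
move=> ls /dvdnP[i ei] lt /dvdnP[j ej] h.
have : (j * d < i.+1 * d)%N by rewrite mulSn; lia.
rewrite ltn_mul2r => /andP[_ ji].
by have : (j * d <= i * d)%N by [rewrite leq_mul2r -ltnS ji orbT]; lia.
Qed.

Lemma box_wordsP (Q : finType) (n : nat) (X : set (Z2 -> Q)) w :
  reflect (exists2 x, X x & box_restriction n x = w) (w \in box_words n X).
Proof. by rewrite inE; apply: asboolP. Qed.

Lemma recoverable_box_words_le (Q : finType) (l r b a n : nat)
    (X : set (Z2 -> Q)) : recoverable (recovery_box l r b a) X ->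
  (#|box_words n X| <= #|Q| ^ (n * n -
     #|lattice_points n l r r.+1| * #|lattice_points n b a b.+1|))%N.
Proof.
move=> [[x0 _] rec].
set P1 := lattice_points _ _ _ _; set P2 := lattice_points _ _ _ _.
rewrite -cardsX -[n in (n * n)%N]card_ord -card_prod.
apply: (card_determined_le _ _ (x0 (0, 0))) => v w.
move=> /box_wordsP[x Xx <-] /box_wordsP[y Xy <-] agree.
have agree' (s t : nat) (sn : (s < n)%N) (tn : (t < n)%N) :
    (Ordinal sn, Ordinal tn) \notin finset.setX P1 P2 ->
    x (Posz s, Posz t) = y (Posz s, Posz t).
  by move=> /agree; rewrite !ffunE.
(* Induction on [s + (n - t)]: the order is from left to right and from top to bottom. *)
suff det k : forall s t : nat, (s + (n - t) < k)%N -> (s < n)%N -> (t < n)%N ->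
    x (Posz s, Posz t) = y (Posz s, Posz t).
  by apply/ffunP => -[s t]; rewrite !ffunE; apply: (det (s + (n - t)).+1).
elim: k => // k IH s t hk sn tn.
have [|/agree'//] := boolP ((Ordinal sn, Ordinal tn) \in finset.setX P1 P2).
rewrite !inE /= => /andP[/and3P[ls ds sr] /and3P[bt dt ta]].
have [f hf] := rec (Posz s, Posz t).
rewrite (hf x Xx) (hf y Xy); congr f; apply/ffunP => z; rewrite !ffunE.
have := fsvalP z; rewrite mem_recovery_box; case: (fsval z) => z1 z2 /=.
move=> /and3P[/andP[z1l z1r] /andP[z2l z2r] z0].
(* The margins [l] and [b] make the neighbour's coordinates nonnegative; [r] and [a] keep them below
   [n]. *)
have [s' es] : exists s' : nat, Posz s + z1 = Posz s'.
  by exists (absz (Posz s + z1)); lia.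
have [t' et] : exists t' : nat, Posz t + z2 = Posz t'.
  by exists (absz (Posz t + z2)); lia.
have sn' : (s' < n)%N by lia.
have tn' : (t' < n)%N by lia.
rewrite /GRing.add /= /add_pair /= es et.
have [|/agree'//] := boolP ((Ordinal sn', Ordinal tn') \in finset.setX P1 P2).
rewrite !inE /= => /andP[/and3P[ls' ds' _] /and3P[bt' dt' _]].
apply: IH => //.
(* A lattice neighbour is at most [r] to the right and at most [b] below, less than one period, so
   it is weakly to the left and weakly above. *)
have ss : (s' <= s)%N by apply: (congruent_le r.+1 l) => //; clear -es z1r; lia.
have tt' : (t <= t')%N by apply: (congruent_le b.+1 b) => //; clear -et z2l; lia.
have : (s' != s) || (t' != t).
  rewrite -negb_and; apply: contra z0 => /andP[/eqP e1 /eqP e2].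
  have -> : z1 = 0 by apply: (addrI (Posz s)); rewrite es e1 addr0.
  have -> : z2 = 0 by apply: (addrI (Posz t)); rewrite et e2 addr0.
  exact: eqxx.
by clear -hk ss tt' tn'; lia.
Qed.

(** * The tile code and its free positions *)

Section TileCode.
Variables (Q : finType) (d e : nat).
Hypotheses (hQ : (0 < #|Q|)%N) (d0 : (0 < d)%N) (e0 : (0 < e)%N).

Definition tile_point (c : Z2) (p : 'I_d * 'I_e) : Z2 :=
  (c.1 * Posz d + Posz p.1, c.2 * Posz e + Posz p.2).

(** Numbering the symbols by [enum_rank] gives a checksum modulo [#|Q|] without a group structure on
    [Q]. *)
Definition tile_code : set (Z2 -> Q) :=
  [set x | forall c,
    (#|Q| %| \sum_(p : 'I_d * 'I_e) enum_rank (x (tile_point c p)))%N]%classic.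

Lemma tile_pointP (v : Z2) : exists c p, v = tile_point c p.
Proof.
have h1 : (absz (v.1 %% Posz d)%Z < d)%N by lia.
have h2 : (absz (v.2 %% Posz e)%Z < e)%N by lia.
exists ((v.1 %/ Posz d)%Z, (v.2 %/ Posz e)%Z), (Ordinal h1, Ordinal h2).
by case: v h1 h2 => v1 v2 /= h1 h2; rewrite /tile_point /=; congr (_, _); lia.
Qed.

(** The other symbols of the tile lie in [v + S], and with them the checksum fixes the rank of [x v]
    modulo [#|Q|], hence [x v] itself. *)
Lemma tile_code_recoverable_at (S : {fset Z2}) (v : Z2) :
  (forall c p p', v = tile_point c p -> p' != p -> tile_point c p' - v \in S) ->
  exists f : {ffun S -> Q} -> Q, forall x, tile_code x -> x v = f (neighborhood S x v).
Proof.
move=> hS.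
have unique x y : tile_code x -> tile_code y ->
    neighborhood S x v = neighborhood S y v -> x v = y v.
  move=> cx cy nxy; have [c [p vE]] := tile_pointP v.
  have /eqP := etrans (eqP (cx c)) (esym (eqP (cy c))).
  rewrite (bigD1 p) // [X in _ == X %[mod _]](bigD1 p) //=.
  rewrite (@eq_bigr _ _ _ _ _ _ (fun p' => enum_rank (x (tile_point c p')) : nat)
             (fun p' => enum_rank (y (tile_point c p')) : nat)).
    rewrite eqn_modDr !modn_small ?ltn_ord // -vE => /eqP h.
    by apply: enum_rank_inj; apply: val_inj.
  move=> p' /(hS c p p' vE) hz.
  have := congr1 (fun g : {ffun S -> Q} => g [` hz]%fset) nxy.
  by rewrite !ffunE /= addrC subrK => ->.
have [q0 _] := card_gt0P hQ.
(* A pattern is sent to the common value at [v] of the codewords showing it, or to [q0] if there are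
   none. *)
have ex (w : {ffun S -> Q}) : exists q, forall x,
    tile_code x -> neighborhood S x v = w -> x v = q.
  have [[x [cx xw]]|no] := pselect (exists x, tile_code x /\ neighborhood S x v = w).
    by exists (x v) => y cy yw; apply: unique => //; rewrite xw.
  by exists q0 => x cx xw; case: no; exists x.
have [f hf] := choice ex.
by exists f => x cx; apply: hf.
Qed.

(** Each tile has one check symbol, at its corner [o]; whatever the other symbols are, it can be
    chosen to complete the sum. *)
Lemma tile_code_extend (g : Z2 -> Q) : exists2 x, tile_code x &
  forall v, ~~ ((Posz d %| v.1)%Z && (Posz e %| v.2)%Z) -> x v = g v.
Proof.
pose o : 'I_d * 'I_e := (Ordinal d0, Ordinal e0).
have ex (s : nat) : exists q : Q, (#|Q| %| enum_rank q + s)%N.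
  (* The outer reduction handles [s] divisible by [#|Q|], where the difference is [#|Q|], out of
     range. *)
  have h : ((#|Q| - s %% #|Q|) %% #|Q| < #|Q|)%N by rewrite ltn_pmod.
  exists (enum_val (Ordinal h)); rewrite enum_valK /=.
  rewrite /dvdn modnDml -modnDmr subnK ?modnn //.
  by rewrite ltnW // ltn_pmod.
have [q hq] := choice ex.
pose tile_rest c := (\sum_(p : 'I_d * 'I_e | p != o) enum_rank (g (tile_point c p)))%N.
pose x (v : Z2) := if (Posz d %| v.1)%Z && (Posz e %| v.2)%Z
  then q (tile_rest ((v.1 %/ Posz d)%Z, (v.2 %/ Posz e)%Z)) else g v.
have x_off v : ~~ ((Posz d %| v.1)%Z && (Posz e %| v.2)%Z) -> x v = g v.
  by rewrite /x => /negbTE ->.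
exists x => // c; rewrite (bigD1 o) //=.
have -> : x (tile_point c o) = q (tile_rest c).
  by rewrite /x /= !addr0 !dvdz_mull //= !mulzK ?gt_eqF // -surjective_pairing.
rewrite (eq_bigr (fun p => enum_rank (g (tile_point c p)) : nat)); first exact: hq.
move=> p po; rewrite x_off //; apply: contra po => /=.
by rewrite !(sameP dvdz_mod0P eqP) !modzMDl !modz_small ?ltz_nat ?ltn_ord //.
Qed.

(** With zero margins the lattice points are exactly the tile corners in the box; all other
    positions are free, even in tiles cut by the boundary. *)
Lemma tile_code_box_words_ge (n : nat) :
  (#|Q| ^ (n * n - #|lattice_points n 0 0 d| * #|lattice_points n 0 0 e|) <=
   #|box_words n tile_code|)%N.
Proof.
have [q0 _] := card_gt0P hQ.
rewrite -cardsX -[n in (n * n)%N]card_ord -card_prod.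
apply: (card_extendable_ge _ _ q0) => w.
(* Only the values inside the box matter; [absz] and [q0] fill the rest of the plane arbitrarily. *)
pose g (v : Z2) : Q :=
  if insub (absz v.1) is Some s then
    if insub (absz v.2) is Some t then w (s, t) else q0
  else q0.
have [x cx xg] := tile_code_extend g.
exists (box_restriction n x); first by apply/box_wordsP; exists x.
move=> [s t]; rewrite !inE /= !subn0 !addn0 !ltn_ord !andbT => st.
by rewrite ffunE xg //= /g !insubT /= ?ltn_ord // => h1 h2; congr (w (_, _)); apply: val_inj.
Qed.

End TileCode.

Lemma tile_code_recoverable (Q : finType) (l r b a : nat) :
  (0 < #|Q|)%N -> (r <= l)%N -> (b <= a)%N ->
  recoverable (recovery_box l r b a) (tile_code Q r.+1 b.+1).
Proof.
move=> hQ rl ba; split.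
  have [q0 _] := card_gt0P hQ.
  by have [x cx _] := tile_code_extend Q r.+1 b.+1 hQ isT isT (fun=> q0); exists x.
move=> v; apply: tile_code_recoverable_at => // c p p' -> pp'.
have -> : tile_point r.+1 b.+1 c p' - tile_point r.+1 b.+1 c p =
    (Posz p'.1 - Posz p.1, Posz p'.2 - Posz p.2).
  by apply: (@etrans _ _ (c.1 * r.+1 + Posz p'.1 - (c.1 * r.+1 + Posz p.1),
    c.2 * b.+1 + Posz p'.2 - (c.2 * b.+1 + Posz p.2))) => //; congr (_, _); ring.
rewrite mem_recovery_box /=.
case: p p' pp' => -[p1 lp1] [p2 lp2] [[p1' lp1'] [p2' lp2']] /= pp'.
apply/and3P; split; [lia|lia|].
apply: contra pp' => /eqP[h1 h2]; apply/eqP.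
by congr (_, _); apply: val_inj => /=; lia.
Qed.

(** * From word counts to rates *)

Section Rate.
Variables (K : realType) (Q : finType).
Hypothesis hQ : (2 <= #|Q|)%N.

Let lnQ_gt0 : 0 < ln (#|Q|%:R : K).
Proof. by rewrite ln_gt0 // ltr1n. Qed.

Lemma log_card_expn (m : nat) : ln ((#|Q| ^ m)%N%:R : K) / ln #|Q|%:R = m%:R.
Proof.
rewrite natrX lnXn ?ltr0n ?(ltnW hQ) // -[_ *+ m]mulr_natl -mulrA.
by rewrite mulfV ?mulr1 // (gt_eqF lnQ_gt0).
Qed.

(** The limsup is an infimum of suprema over sets of the filter, and on each such set the supremum
    of [v] dominates that of [u]. *)
Lemma le_limn_esup (u v : nat -> \bar K) :
  (forall n, u n <= v n)%E -> (limn_esup u <= limn_esup v)%E.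
Proof.
move=> uv; apply/ereal_infP => _ [V FV <-].
apply: ge_ereal_inf; exists (ereal_sup (u @` V)%classic); first by exists V.
apply: ge_ereal_sup => _ [n Vn <-]; apply: le_ereal_sup_tmp.
by exists (v n); [exists n|exact: uv].
Qed.

Variables (d e C : nat) (u v : nat -> nat).
Hypotheses (d0 : (0 < d)%N) (e0 : (0 < e)%N).
Hypotheses (u_ge : forall n, (n <= d * u n + C)%N)
  (u_le : forall n, (d * u n <= n + C)%N).
Hypotheses (v_ge : forall n, (n <= e * v n + C)%N)
  (v_le : forall n, (e * v n <= n + C)%N).
Hypothesis uv_le : forall n, (u n * v n <= n * n)%N.

(** Of the [n * n] positions, [u n * v n] are dependent. Only the densities of [u] and [v] affect
    the limit, so lattices with different margins share it. *)
Let free_density (n : nat) : \bar K :=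
  ((ln ((#|Q| ^ (n * n - u n * v n))%N%:R : K) / ln #|Q|%:R) / n%:R ^+ 2)%:E.

(** For [n > 0] the term is [1 - (u n / n) * (v n / n)]. *)
Let limn_esup_free_density :
  limn_esup free_density = (1 - 1 / (d%:R * e%:R))%:E.
Proof.
suff : (free_density @ \oo --> (1 - 1 / (d%:R * e%:R) : K)%:E)%classic.
  by move/cvg_limn_einf_sup => [].
apply: cvg_EFin; first by near=> n.
have h : ((fun n => 1 - (u n)%:R / n%:R * ((v n)%:R / n%:R) : K) @ \oo -->
    (1 - d%:R^-1 * e%:R^-1 : K))%classic.
  by apply: cvgB; [exact: cvg_cst|apply: cvgM; apply: (cvg_density _ _ _ C)].
rewrite mul1r invfM; apply: cvg_trans h; apply: near_eq_cvg; near=> n => /=.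
rewrite log_card_expn natrB // !natrM.
have n0 : n%:R != 0 :> K by rewrite pnatr_eq0 -lt0n; near: n; exists 1%N.
by field.
Unshelve. all: by end_near.
Qed.

Lemma rate_le (X : set (Z2 -> Q)) :
  (forall n, #|box_words n X| <= #|Q| ^ (n * n - u n * v n))%N ->
  (rate K X <= (1 - 1 / (d%:R * e%:R))%:E)%E.
Proof.
move=> hX; rewrite -limn_esup_free_density; apply: le_limn_esup => n.
rewrite lee_fin ler_wpM2r ?invr_ge0 ?sqr_ge0 // ler_wpM2r ?invr_ge0 ?(ltW lnQ_gt0) //.
(* Without words the logarithm is [ln 0 = 0] by convention, and the bound is nonnegative. *)
have [->|B0] := posnP #|box_words n X|.
  by rewrite ln0 // ln_ge0 // ler1n expn_gt0 (ltnW hQ).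
by rewrite ler_ln ?posrE ?ltr0n ?expn_gt0 1?(ltnW hQ) ?ler_nat.
Qed.

Lemma rate_ge (X : set (Z2 -> Q)) :
  (forall n, #|Q| ^ (n * n - u n * v n) <= #|box_words n X|)%N ->
  ((1 - 1 / (d%:R * e%:R))%:E <= rate K X)%E.
Proof.
move=> hX; rewrite -limn_esup_free_density; apply: le_limn_esup => n.
rewrite lee_fin ler_wpM2r ?invr_ge0 ?sqr_ge0 // ler_wpM2r ?invr_ge0 ?(ltW lnQ_gt0) //.
have Qn0 : (0 < #|Q| ^ (n * n - u n * v n))%N by rewrite expn_gt0 (ltnW hQ).
by rewrite ler_ln ?posrE ?ltr0n ?ler_nat // (leq_trans Qn0).
Qed.

End Rate.

(** * The capacity *)

Lemma lattice_points_mul_le (n lo hi d lo' hi' d' : nat) :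
  (#|lattice_points n lo hi d| * #|lattice_points n lo' hi' d'| <= n * n)%N.
Proof. by apply: leq_mul; rewrite -[X in (_ <= X)%N]card_ord max_card. Qed.

Theorem theorem5p3 (K : realType) (Q : finType) (hQ : (2 <= #|Q|)%N)
    (l r b a : nat) (hl : (0 < l)%N) (hr : (0 < r)%N) (hb : (0 < b)%N)
    (ha : (0 < a)%N) (hrl : (r < l)%N) (hba : (b < a)%N) :
  capacity K Q (recovery_box l r b a) =
  (1 - 1 / ((r%:R + 1) * (b%:R + 1)))%:E.
Proof.
rewrite !natr1; apply/le_anti/andP; split.
  apply: ge_ereal_sup => _ [X recX <-].
  (* The constant dominates the boundary terms of both axes, [l + r + r.+1] and [b + a + b.+1]. *)
  apply: (rate_le _ _ hQ r.+1 b.+1 (l + r + r + b + b + a).+1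
    (fun n => #|lattice_points n l r r.+1|) (fun n => #|lattice_points n b a b.+1|)) => // n.
  - by apply: leq_trans (lattice_points_ge n l r r.+1 isT) _; rewrite leq_add2l; lia.
  - by apply: leq_trans (lattice_points_le n l r r.+1 isT) _; rewrite leq_add2l; lia.
  - by apply: leq_trans (lattice_points_ge n b a b.+1 isT) _; rewrite leq_add2l; lia.
  - by apply: leq_trans (lattice_points_le n b a b.+1 isT) _; rewrite leq_add2l; lia.
  - exact: lattice_points_mul_le.
  - exact: recoverable_box_words_le.
apply: (@le_trans _ _ (rate K (tile_code Q r.+1 b.+1))); last first.
  apply: ereal_sup_ubound; exists (tile_code Q r.+1 b.+1) => //.
  by apply: tile_code_recoverable; rewrite ltnW.
(* With zero margins the boundary terms are just the periods [r.+1] and [b.+1]. *)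
apply: (rate_ge _ _ hQ r.+1 b.+1 (r + b).+1
  (fun n => #|lattice_points n 0 0 r.+1|) (fun n => #|lattice_points n 0 0 b.+1|)) => // n.
- by apply: leq_trans (lattice_points_ge n 0 0 r.+1 isT) _; rewrite leq_add2l; lia.
- by apply: leq_trans (lattice_points_le n 0 0 r.+1 isT) _; rewrite leq_add2l; lia.
- by apply: leq_trans (lattice_points_ge n 0 0 b.+1 isT) _; rewrite leq_add2l; lia.
- by apply: leq_trans (lattice_points_le n 0 0 b.+1 isT) _; rewrite leq_add2l; lia.
- exact: lattice_points_mul_le.
- by apply: tile_code_box_words_ge; rewrite // ltnW.
Qed.
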